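(* For every integer $n \ge 4$, $\chi_{la}(C_n \circ \overline{K_2}) = 2n+2$, where $C_n$ is the cycle on $n$ vertices.
   Context: Let $G=(V,E)$ be a finite simple undirected graph with no component isomorphic to $K_2$. A bijection $f : E \to \{1,2,\dots,|E|\}$ is a local antimagic labeling of $G$ if $w(u)\ne w(v)$ for every pair of adjacent vertices $u,v$, where $w(u)=\sum_{e\in E(u)} f(e)$ and $E(u)$ is the set of edges incident to $u$. Such an $f$ induces the proper vertex coloring $v\mapsto w(v)$, which uses $|\{w(v): v\in V\}|$ colors. The local antimagic chromatic number $\chi_{la}(G)$ is the minimum number of colors used over all colorings induced by local antimagic labelings of $G$ (so $\chi_{la}(G)\le k$ means that there is a local antimagic labeling inducing at most $k$ colors). The corona product $G\circ H$ is obtained from one copy of $G$ and $|V(G)|$ copies of $H$ by joining the $i$-th vertex of $G$ to every vertex of the $i$-th copy of $H$, for $1\le i\le |V(G)|$. $\overline{K_m}$ is the null (edgeless) graph on $m$ vertices. *)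

(* Defs.v *)
From mathcomp Require Import all_boot.

Set Implicit Arguments.
Unset Strict Implicit.
Unset Printing Implicit Defensive.

Record sgraph := SGraph {
  vertex :> finType;
  adj : rel vertex;
  adj_sym : symmetric adj;
  adj_irrefl : irreflexive adj
}.

Definition edges (G : sgraph) : {set {set G}} :=
  [set A : {set G} | [exists u : G, exists v : G, adj u v && (A == [set u; v])]].

Definition edge (G : sgraph) : finType := {A : {set G} | A \in edges G}.

(* The codomain is nat; that the image is exactly {1, ..., |E|} is part of
   [edge_bijection]. *)
Definition edge_labeling (G : sgraph) : Type := edge G -> nat.

Definition edge_bijection (G : sgraph) (f : edge_labeling G) : Prop :=
  injective f /\ forall k : nat, (exists e, f e = k) <-> 1 <= k <= #|edges G|.

Definition weight (G : sgraph) (f : edge_labeling G) (v : G) : nat :=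
  \sum_(e : edge G | v \in val e) f e.

Definition local_antimagic (G : sgraph) (f : edge_labeling G) : Prop :=
  edge_bijection f /\ forall u v : G, adj u v -> weight f u != weight f v.

Definition num_colors (G : sgraph) (f : edge_labeling G) : nat :=
  size (undup [seq weight f v | v : G]).

(* [chi_la_eq G k] reads chi_la(G) = k.  It is a relation because the minimum is
   undefined for graphs with no local antimagic labeling; these include all
   graphs with a component K_2, whose two vertices always have equal weights, so
   the relation holds for no k on such graphs. *)
Definition chi_la_eq (G : sgraph) (k : nat) : Prop :=
  (exists f : edge_labeling G, local_antimagic f /\ num_colors f = k) /\
  (forall f : edge_labeling G, local_antimagic f -> k <= num_colors f).

Section Cycle.
Variable n : nat.

(* For n >= 3 this is the cycle C_n; the conjunct [i != j] only matters for
   n = 1, where it removes the loop. *)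
Definition cycle_adj : rel 'I_n :=
  fun i j => (i != j) && ((j == ordS i) || (i == ordS j)).

Lemma cycle_adj_sym : symmetric cycle_adj.
Proof. by move=> i j; rewrite /cycle_adj eq_sym orbC. Qed.

Lemma cycle_adj_irrefl : irreflexive cycle_adj.
Proof. by move=> i; rewrite /cycle_adj eqxx. Qed.

Definition cycle_graph : sgraph := SGraph cycle_adj_sym cycle_adj_irrefl.
End Cycle.

Section Null.
Variable m : nat.

Definition null_adj : rel 'I_m := fun _ _ => false.

Lemma null_adj_sym : symmetric null_adj. Proof. by []. Qed.

Lemma null_adj_irrefl : irreflexive null_adj. Proof. by []. Qed.

Definition null_graph : sgraph := SGraph null_adj_sym null_adj_irrefl.
End Null.

Section Corona.
Variables G H : sgraph.

(* [inl u] is the vertex u of G, and [inr (u, x)] is the vertex x in the copy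
   of H attached to u. *)
Definition corona_adj : rel (G + G * H) := fun a b =>
  match a, b with
  | inl u, inl v => adj u v
  | inl u, inr (v, _) => u == v
  | inr (u, _), inl v => u == v
  | inr (u, x), inr (v, y) => (u == v) && adj x y
  end.

Lemma corona_adj_sym : symmetric corona_adj.
Proof.
by case=> [u|[u x]] [v|[v y]] /=; rewrite ?[v == u]eq_sym // adj_sym.
Qed.

Lemma corona_adj_irrefl : irreflexive corona_adj.
Proof. by case=> [u|[u x]] /=; rewrite ?adj_irrefl ?andbF. Qed.

Definition corona : sgraph := SGraph corona_adj_sym corona_adj_irrefl.
End Corona.

(* Main.v *)
(* Write [c] for the labels of the cycle edges and [P] for the set of the [2n]
   pendant labels, which are also the weights of the leaves.

   Lower bound: with fewer than [2n + 2] colors, two adjacent cycle vertices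
   cannot both have a weight outside [P], so the set [S] of the cycle vertices
   with weight in [P], hence at most [3n], is a vertex cover of the cycle. The
   edges meeting [S] include all cycle edges and the [2|S|] pendant edges at [S],
   so with [s = |S|] the weights on [S] add up to at least
   [(n + 2s)(n + 2s + 1) / 2], which by AM-GM is more than [4ns]. But they add up
   to at most [3ns].

   Upper bound: give one cycle vertex such small pendant labels that its own
   weight is a pendant label. The rest of the cycle is a path, on which the
   zigzag labeling of the cycle edges makes the sums [c (i-1) + c i] alternate
   between two consecutive values, while the remaining pendant labels form
   pairs of constant sum. *)
Require Import Defs.
From mathcomp Require Import all_boot.
From mathcomp Require Import zify.

Set Implicit Arguments.
Unset Strict Implicit.
Unset Printing Implicit Defensive.

(** * Distinct positive integers: sums and pigeonhole *)

Lemma sumn_uniq_pos (s : seq nat) :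
  uniq s -> 0 \notin s -> size s * (size s).+1 <= 2 * sumn s.
Proof.
move: {2}(size s) (erefl (size s)) => k.
elim: k s => [|k IHk] s; first by move/size0nil->.
move=> szs us s0.
(* Otherwise the [k.+1] distinct entries would all lie in [iota 1 k]. *)
have [x xs lex] : exists2 x, x \in s & size s <= x.
  apply/hasP; apply: contraT => /hasPn ltx.
  have: size s <= size (iota 1 k).
    apply: uniq_leq_size => // y ys; rewrite mem_iota.
    have := ltx y ys; rewrite szs -ltnNge.
    by case: y ys => [|y _]; [rewrite (negPf s0) | lia].
  by rewrite size_iota szs ltnn.
have szr : size (rem x s) = k by rewrite size_rem // szs.
have := IHk (rem x s) szr (rem_uniq x us).
have -> : 0 \notin rem x s by apply: contra s0; apply: mem_rem.
move/(_ isT); rewrite szr.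
have -> : sumn s = x + sumn (rem x s) by rewrite (perm_sumn (perm_to_rem xs)).
by move: lex; rewrite szs; nia.
Qed.

Lemma sum_inj_pos (T : finType) (D : {set T}) (g : T -> nat) :
  injective g -> (forall t, 0 < g t) -> #|D| * #|D|.+1 <= 2 * \sum_(t in D) g t.
Proof.
move=> g_inj g_gt0.
have := @sumn_uniq_pos [seq g t | t in D].
rewrite size_map -cardE sumnE big_image /=; apply.
  by rewrite map_inj_uniq ?enum_uniq.
by apply/mapP => -[t _ g0]; have := g_gt0 t; rewrite -g0.
Qed.

Lemma inj_pos_surj (T : finType) (g : T -> nat) :
  injective g -> (forall t, 0 < g t <= #|T|) ->
  forall k, 0 < k <= #|T| -> exists t, g t = k.
Proof.
move=> g_inj g_bnd k k_bnd.
have g_lt t : (g t).-1 < #|T| by have := g_bnd t; lia.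
have h_inj : injective (fun t => Ordinal (g_lt t)).
  move=> t u [gtu]; apply: g_inj.
  by have := g_bnd t; have := g_bnd u; lia.
have k_lt : k.-1 < #|T| by lia.
have [|h' _ hK] := inj_card_bij h_inj; first by rewrite card_ord.
set t := h' (Ordinal k_lt); exists t.
have gt : (g t).-1 = k.-1 := congr1 val (hK (Ordinal k_lt)).
by have := g_bnd t; lia.
Qed.

(** * Edges and weights of the corona of a cycle *)

Section CoronaCycle.
Variables n m : nat.
Hypothesis n_ge3 : 3 <= n.
Local Notation G := (corona (cycle_graph n) (null_graph m)).

(* [(i, None)] indexes the cycle edge from [i] to [ordS i], and [(i, Some x)]
   the pendant edge from [i] to [(i, x)]. *)
Local Notation K := ('I_n * option 'I_m)%type.

Definition corona_pair (k : K) : {set G} :=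
  [set (inl k.1 : G); if k.2 is Some x then (inr (k.1, x) : G)
                      else (inl (ordS k.1) : G)].

Lemma in_pair_inl (i : 'I_n) (k : K) :
  ((inl i : G) \in corona_pair k) =
  (k.1 == i) || (k.2 == None) && (k.1 == ord_pred i).
Proof.
rewrite !inE; case: k => j [x|] /=; first by rewrite !orbF eq_sym.
by rewrite eq_sym; congr (_ || _); apply/eqP/eqP => [[->]|->]; rewrite ?ordSK ?ord_predK.
Qed.

Lemma in_pair_inr (i : 'I_n) (x : 'I_m) (k : K) :
  ((inr (i, x) : G) \in corona_pair k) = (k == (i, Some x)).
Proof.
rewrite !inE; case: k => j [y|] /=; last by apply/esym/eqP.
by rewrite eq_sym.
Qed.

Lemma val_ordS (i : 'I_n) : ordS i = (if i.+1 == n then 0 else i.+1) :> nat.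
Proof.
rewrite /=; case: eqP => [->|]; first exact: modnn.
by have := ltn_ord i; move=> lt_i ne_i; rewrite modn_small //; lia.
Qed.

Lemma ordS_neq (i : 'I_n) : ordS i != i.
Proof.
apply/eqP => /(congr1 (@nat_of_ord n)); rewrite val_ordS.
by have := ltn_ord i; case: eqP => /=; lia.
Qed.

Lemma val_ord_pred (i : 'I_n) :
  ord_pred i = (if i == 0 :> nat then n.-1 else i.-1) :> nat.
Proof.
move: (ord_pred i) (ord_predK i) => j <-; rewrite val_ordS.
by have := ltn_ord j; case: (j.+1 =P n) => /=; lia.
Qed.

Lemma corona_pair_edge (k : K) : corona_pair k \in edges G.
Proof.
rewrite inE; apply/existsP; exists (inl k.1); apply/existsP.
case: k => i [x|] /=.
  by exists (inr (i, x)); rewrite /= eqxx /corona_pair eqxx.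
exists (inl (ordS i)); rewrite /= /corona_pair eqxx andbT.
by rewrite /cycle_adj eqxx andbT eq_sym ordS_neq.
Qed.

Definition corona_edge (k : K) : edge G :=
  exist (fun A => A \in edges G) (corona_pair k) (corona_pair_edge k).

Lemma corona_pair_inj : injective corona_pair.
Proof.
move=> [i o] [j p] eq_ij; case: o eq_ij => [x|] eq_ij.
  have : (inr (i, x) : G) \in corona_pair (j, p) by rewrite -eq_ij in_pair_inr.
  by rewrite in_pair_inr => /eqP.
case: p eq_ij => [y|] eq_ij.
  have : (inr (j, y) : G) \in corona_pair (i, None) by rewrite eq_ij in_pair_inr.
  by rewrite in_pair_inr => /eqP.
have : (inl i : G) \in corona_pair (j, None) by rewrite -eq_ij in_pair_inl eqxx.
have : (inl j : G) \in corona_pair (i, None) by rewrite eq_ij in_pair_inl eqxx.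
rewrite !in_pair_inl /= => /orP[/eqP-> // | /eqP ij] /orP[/eqP-> //| /eqP ji].
(* Here [i] and [j] precede each other on the cycle, which is impossible for [n >= 3]. *)
have := congr1 (@nat_of_ord n) ij; have := congr1 (@nat_of_ord n) ji.
rewrite !val_ord_pred /=.
by have := ltn_ord i; have := ltn_ord j; do 2 case: eqP; lia.
Qed.

Lemma corona_edge_bij : bijective corona_edge.
Proof.
apply: inj_card_bij => [k l /(congr1 val)/corona_pair_inj // |].
apply: leq_trans (leq_image_card corona_edge predT).
rewrite cardE -(card_uniqP (enum_uniq _)).
apply: subset_leq_card; apply/subsetP => -[A AE] _.
suff [k Ak] : exists k, A = corona_pair k.
  by apply/imageP; exists k => //; apply: val_inj.
move: (AE); rewrite inE => /existsP[u /existsP[v /andP[+ /eqP->]]].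
case: u v => [i|[i x]] [j|[j y]] //=.
- case/andP=> _ /orP[] /eqP->; [by exists (i, None) | exists (j, None)].
  by rewrite /corona_pair setUC.
- by move/eqP->; exists (j, Some y).
- by move/eqP->; exists (j, Some x); rewrite /corona_pair setUC.
- by rewrite /null_adj andbF.
Qed.

Lemma card_corona_index : #|{: K}| = n * m.+1.
Proof. by rewrite card_prod card_option !card_ord. Qed.

Lemma card_corona_edges : #|edges G| = n * m.+1.
Proof.
rewrite -card_corona_index (bij_eq_card corona_edge_bij) card_sig.
by apply: eq_card => A.
Qed.

Lemma big_option (I : finType) (F : option I -> nat) :
  \sum_o F o = F None + \sum_i F (Some i).
Proof.
rewrite (bigD1 None) //=; congr (_ + _).
by rewrite (reindex_omap Some id) => [|[]//] /=; apply: eq_bigl => i; rewrite eqxx.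
Qed.

Lemma weightE (f : edge_labeling G) (v : G) :
  weight f v = \sum_(k : K | v \in corona_pair k) f (corona_edge k).
Proof.
by rewrite /weight (reindex corona_edge) //; apply/onW_bij/corona_edge_bij.
Qed.

Lemma weight_inr (f : edge_labeling G) i x :
  weight f (inr (i, x)) = f (corona_edge (i, Some x)).
Proof.
by rewrite weightE (big_pred1 (i, Some x)) // => k; rewrite in_pair_inr.
Qed.

Lemma weight_inl (f : edge_labeling G) i :
  weight f (inl i) = f (corona_edge (ord_pred i, None))
    + f (corona_edge (i, None)) + \sum_x f (corona_edge (i, Some x)).
Proof.
rewrite weightE (bigID (fun k : K => k.1 == i)) /= addnC -addnA; congr (_ + _).
  rewrite (big_pred1 (ord_pred i, None)) // => -[j o].
  rewrite in_pair_inl /= xpair_eqE; case: eqP => [->|_] /=.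
    apply/esym; apply/negP => /andP[/eqP ij _].
    by have := ordS_neq (ord_pred i); rewrite ord_predK -ij eqxx.
  by rewrite andbT andbC.
rewrite -(big_option (fun o => f (corona_edge (i, o)))).
rewrite -[RHS](big_pred1_eq addn i (fun i => \sum_o f (corona_edge (i, o)))) pair_big /=.
apply: eq_big => -[j o] //; rewrite in_pair_inl /=.
by case: (j == i); rewrite ?andbF.
Qed.

(** Transport of [g] along the inverse of [corona_edge]; since that map is onto, the default 0 is
    never reached. *)
Definition index_labeling (g : K -> nat) : edge_labeling G :=
  fun e => odflt 0 (omap g [pick k | corona_edge k == e]).

Lemma index_labelingE g k : index_labeling g (corona_edge k) = g k.
Proof.
rewrite /index_labeling; case: pickP => [l /eqP/(bij_inj corona_edge_bij)-> //|].
by move/(_ k); rewrite eqxx.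
Qed.

Lemma index_labeling_bij (g : K -> nat) :
  injective g -> (forall k, 0 < g k <= n * m.+1) -> edge_bijection (index_labeling g).
Proof.
move=> g_inj g_bnd; have [e' eK e'K] := corona_edge_bij.
split=> [a b|k].
  by rewrite -[a]e'K -[b]e'K !index_labelingE => /g_inj->.
rewrite card_corona_edges; split=> [[e <-]|k_bnd].
  by rewrite -[e]e'K index_labelingE.
have [||t <-] := inj_pos_surj g_inj _ (k := k); rewrite ?card_corona_index //.
by exists (corona_edge t); rewrite index_labelingE.
Qed.

(** * The lower bound, for any [m > 0] pendant edges per cycle vertex *)

Lemma num_colors_corona_ge (f : edge_labeling G) :
  0 < m -> local_antimagic f -> m * n + 2 <= num_colors f.
Proof.
move=> m_gt0 [[f_inj f_rng] f_adj]; rewrite leqNgt; apply/negP => few.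
pose g k := f (corona_edge k).
have g_inj : injective g by move=> k l /f_inj/(bij_inj corona_edge_bij).
have g_bnd k : 0 < g k <= n * m.+1.
  by rewrite -card_corona_edges; apply/f_rng; exists (corona_edge k).
pose P := [seq g (p.1, Some p.2) | p : 'I_n * 'I_m].
have P_uniq : uniq P.
  by rewrite map_inj_uniq ?enum_uniq // => -[i x] [j y] /g_inj[-> ->].
have P_size : size P = m * n.
  by rewrite size_map -cardE card_prod !card_ord mulnC.
have P_bnd c : c \in P -> c <= n * m.+1.
  by case/mapP => p _ ->; case/andP: (g_bnd (p.1, Some p.2)).
have cover i : (weight f (inl i) \in P) || (weight f (inl (ordS i)) \in P).
  apply: contraT; rewrite negb_or => /andP[iP SiP].
  suff : size [:: weight f (inl i), weight f (inl (ordS i)) & P] <= num_colors f.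
    by rewrite /= P_size -addn2 leqNgt few.
  apply: uniq_leq_size => [|c] /=.
    rewrite in_cons negb_or iP SiP P_uniq !andbT f_adj //=.
    by rewrite /cycle_adj eqxx andbT eq_sym ordS_neq.
  rewrite mem_undup !in_cons => /or3P[/eqP->|/eqP->|/mapP[p _ ->]];
    [exact: codom_f..|].
  by rewrite /g -weight_inr; apply: codom_f.
pose S := [set i : 'I_n | weight f (inl i) \in P].
pose D := [set k : K | (k.2 == None) || (k.1 \in S)].
have D_card : #|D| = n + m * #|S|.
  rewrite -sum1_card big_mkcond /=.
  transitivity (\sum_(i < n) \sum_(o : option 'I_m) ((o == None) || (i \in S))).
    by rewrite pair_bigA; apply: eq_bigr => -[i o] _; rewrite inE /=; case: (_ || _).
  under eq_bigr => i _ do rewrite big_option sum_nat_const card_ord.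
  by rewrite big_split /= sum1_card card_ord -big_distrr /= -big_mkcond sum1_card.
have D_le : \sum_(k in D) g k <= \sum_(i in S) weight f (inl i).
  rewrite [leqRHS](eq_bigr _ (fun i _ => weightE f (inl i : G))).
  (* After the exchange, each label [g k] with [k] in [D] is counted at least once, as its edge has
     an end in [S]. *)
  rewrite (exchange_big_dep predT) //= big_mkcond.
  apply: leq_sum => k _; case: ifP => //.
  rewrite inE => kD.
  suff [i iS ik] : exists2 i, i \in S & (inl i : G) \in corona_pair k.
    by rewrite (bigD1 i) ?iS //= leq_addr.
  case/orP: kD => [/eqP k0 | kS]; last by exists k.1; rewrite ?in_pair_inl ?eqxx.
  case/orP: (cover k.1) => kP.
    by exists k.1; rewrite ?in_pair_inl ?eqxx // inE.
  by exists (ordS k.1); rewrite ?in_pair_inl ?ordSK ?k0 ?eqxx ?orbT // inE.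
have S_le : \sum_(i in S) weight f (inl i) <= #|S| * (n * m.+1).
  by rewrite -sum_nat_const; apply: leq_sum => i; rewrite inE => /P_bnd.
have := sum_inj_pos D g_inj (fun k => proj1 (andP (g_bnd k))).
rewrite D_card.
have := leq_trans D_le S_le; move: (\sum_(k in D) g k) (#|S|) => sg s les leg.
(* Twice the label sum is at most [2ns(m + 1) <= 4nms], as [m >= 1], but at least
   [(n + ms)^2 + (n + ms)], which is strictly larger. *)
have : 4 * (n * (m * s)) <= (n + m * s) ^ 2 by rewrite nat_AGM2.
have : n * s <= n * (m * s) by rewrite leq_mul2l leq_pmull ?orbT.
nia.
Qed.

End CoronaCycle.

Local Ltac if_lia := repeat (case: ifP => ?); lia.

(** * A labeling with at most [2n + 2] colors *)

Section TwoPendantLabeling.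
Variable n : nat.
Hypothesis n_ge4 : 4 <= n.
Let n_ge3 : 3 <= n := ltnW n_ge4.
Local Notation G := (corona (cycle_graph n) (null_graph 2)).

(* The weight of vertex [0] has to land in the set of pendant labels; the
   uniform choice of labels around it is too large by one when [n = 4]. *)
Definition cycle_shift := if n == 4 then 2 else 1.

(** The zigzag on the labels [cycle_shift + 1] to [cycle_shift + n]: even positions climb from the
    bottom, odd ones descend from the top. *)
Definition cycle_label (i : nat) :=
  if odd i then cycle_shift + n - i./2 else cycle_shift + i./2 + 1.

(** Vertex 0 takes the two labels up to [n + 2] that the cycle leaves free; the labels [n + 3] to
    [3n] are paired with sum [4n + 3]. *)
Definition pendant_label (i x : nat) :=
  if i == 0 then (if x == 0 then 1 else if n == 4 then 2 else n + 2)
  else if x == 0 then n + 2 + i else 3 * n + 1 - i.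

Definition two_pendant_label (k : 'I_n * option 'I_2) :=
  if k.2 is Some x then pendant_label k.1 x else cycle_label k.1.

Lemma two_pendant_label_inj : injective two_pendant_label.
Proof.
move=> [i o] [j p]; rewrite /two_pendant_label /=.
have := ltn_ord i; have := ltn_ord j.
case: o p => [x|] [y|]; rewrite /pendant_label /cycle_label /cycle_shift.
- have := ltn_ord x; have := ltn_ord y => lty ltx ltj lti eq_ij.
  have [ij xy] : i = j :> nat /\ x = y :> nat by split; move: eq_ij; if_lia.
  by rewrite (val_inj ij) (val_inj xy).
- by if_lia.
- by if_lia.
- move=> ltj lti eq_ij; have ij : i = j :> nat by move: eq_ij; if_lia.
  by rewrite (val_inj ij).
Qed.

Lemma two_pendant_label_bnd k : 0 < two_pendant_label k <= n * 3.
Proof.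
case: k => i [x|]; rewrite /two_pendant_label /= /pendant_label /cycle_label /cycle_shift;
  have := ltn_ord i; if_lia.
Qed.

Local Notation f := (index_labeling n_ge3 two_pendant_label).

Lemma two_pendant_weight_inr i x : weight f (inr (i, x) : G) = pendant_label i x.
Proof. by rewrite weight_inr // index_labelingE. Qed.

Lemma two_pendant_weight_inl (i : 'I_n) :
  weight f (inl i : G) = cycle_label (if i == 0 :> nat then n.-1 else i.-1)
     + cycle_label i + (pendant_label i 0 + pendant_label i 1).
Proof.
rewrite weight_inl // !big_ord_recl big_ord0 addn0 !index_labelingE //.
by rewrite -(val_ord_pred n_ge3 i).
Qed.

Lemma two_pendant_weight_pos (i : 'I_n) : 0 < i ->
  weight f (inl i : G) = 2 * cycle_shift + 5 * n + 5 - odd i.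
Proof.
rewrite two_pendant_weight_inl /pendant_label /cycle_label => i_gt0.
rewrite (gtn_eqF i_gt0) /=.
by rewrite /cycle_shift; have := ltn_ord i; if_lia.
Qed.

(** All labels in this range are pendant, so vertex 0 adds no color. *)
Lemma two_pendant_weight_0 (i : 'I_n) : i = 0 :> nat ->
  n + 2 < weight f (inl i : G) <= n * 3.
Proof.
rewrite two_pendant_weight_inl /pendant_label /cycle_label => -> /=.
by rewrite /cycle_shift; if_lia.
Qed.

Lemma two_pendant_antimagic : local_antimagic f.
Proof.
split.
  apply: index_labeling_bij => //; first exact: two_pendant_label_inj.
  exact: two_pendant_label_bnd.
(* Weights at positive vertices alternate with parity and exceed [3n], whereas the weight at 0 does
   not. *)
have succ (i : 'I_n) : weight f (inl i : G) != weight f (inl (ordS i) : G).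
  have := val_ordS n_ge3 i; have := ltn_ord i.
  have := @two_pendant_weight_pos i; have := @two_pendant_weight_pos (ordS i).
  have := @two_pendant_weight_0 i; have := @two_pendant_weight_0 (ordS i).
  by if_lia.
have pend (i : 'I_n) (x : 'I_2) : weight f (inl i : G) != weight f (inr (i, x) : G).
  have := @two_pendant_weight_pos i; have := @two_pendant_weight_0 i.
  rewrite two_pendant_weight_inr /pendant_label.
  by have := ltn_ord i; if_lia.
case=> [i|[i x]] [j|[j y]] //=.
- by case/andP => _ /orP[] /eqP->; rewrite // eq_sym.
- by move/eqP->.
- by move/eqP->; rewrite eq_sym.
- by rewrite /null_adj andbF.
Qed.

Lemma two_pendant_num_colors : num_colors f <= 2 * n + 2.
Proof.
(* The weight at odd vertices; positive even ones have weight [A.+1]. *)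
pose A := 2 * cycle_shift + 5 * n + 4.
pose P := [seq pendant_label p.1 p.2 | p : 'I_n * 'I_2].
have in_P (i : 'I_n) (x : 'I_2) : pendant_label i x \in P.
  exact: (codom_f (fun p : 'I_n * 'I_2 => pendant_label p.1 p.2) (i, x)).
have -> : 2 * n + 2 = size [:: A, A.+1 & P].
  by rewrite /= size_map -cardE card_prod !card_ord mulnC addn2.
apply: uniq_leq_size (undup_uniq _) _ => c.
rewrite mem_undup => /codomP[[i|[i x]] ->]; rewrite !in_cons; last first.
  by rewrite two_pendant_weight_inr in_P !orbT.
case: (posnP i) => [i0|i_gt0]; last first.
  by rewrite two_pendant_weight_pos // /A; case: odd; lia.
have /andP[w_gt w_le] := two_pendant_weight_0 i0.
(* The weight is some edge's label, and cycle labels are at most [n + 2], so that edge is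
   pendant. *)
have [||[j o] gk] := inj_pos_surj two_pendant_label_inj _ (k := weight f (inl i : G)).
- by move=> k; rewrite card_corona_index two_pendant_label_bnd.
- by rewrite card_corona_index w_le andbT (leq_trans _ w_gt).
move: w_gt; rewrite -gk; case: o {gk} => [x _|].
  by rewrite [_ \in P]in_P !orbT.
by rewrite /two_pendant_label /= /cycle_label /cycle_shift; have := ltn_ord j; if_lia.
Qed.

End TwoPendantLabeling.

Theorem theorem3p9 (n : nat) (hn : 4 <= n) :
  chi_la_eq (corona (cycle_graph n) (null_graph 2)) (2 * n + 2).
Proof.
split; last by move=> f; apply: num_colors_corona_ge => //; apply: ltnW.
exists (index_labeling (ltnW hn) (@two_pendant_label n)).
have anti := two_pendant_antimagic hn; split=> //.
by apply/eqP; rewrite eqn_leq two_pendant_num_colors // num_colors_corona_ge // ltnW.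
Qed.
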